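(* Let $A \in \mathbb{R}^{n\times n}$ be a matrix whose eigenvectors $\phi_1,\dots,\phi_n$ form an orthonormal basis of $\mathbb{R}^n$, with $A\phi_i=\lambda_i\phi_i$ and $|\lambda_1|\ge|\lambda_2|\ge\dots\ge|\lambda_n|$. Let $1\le k<n$ with $\lambda_{k+1}\neq 0$. Suppose that for every $1\le i\le k$ there is an interval $J_i\subset\{1,\dots,n\}$ such that $$\sum_{j\in J_i}\phi_i(j)^2\ge \frac12 ,$$ and put $\mathcal{J}=\max_{1\le i\le k}|J_i|$. Suppose moreover that there is a constant $\beta>0$ such that for all $1\le i\le k$ and all $m\in\{1,\dots,n\}$ $$|\langle \phi_i,e_m\rangle|\le \exp\left(-\beta\cdot \operatorname{dist}(m,J_i)\right).$$ If $\alpha\in\mathbb{N}$ is chosen such that $$\left(\frac{|\lambda_k|}{|\lambda_{k+1}|}\right)^{\alpha}\ge 16\sqrt{\mathcal{J}n},$$ then there exists $y\in\mathbb{R}$ such that $$\min_{1\le i\le k}\ \max_{x\in J_i} f_\alpha(x)\ge y,$$ and such that for every $m\in\{1,\dots,n\}$ with $f_\alpha(m)\ge y-1$, $$\operatorname{dist}\left(m,\bigcup_{i=1}^k J_i\right)\le \frac1\beta\left(\log\left(16\sqrt{k}\sqrt{\mathcal{J}}\right)+\alpha\log\left(\left|\frac{\lambda_1}{\lambda_k}\right|\right)\right).$$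
   Context: For $1\le m\le n$, $e_m=(\delta_{im})_{i=1}^n$ is the $m$-th standard basis vector of $\mathbb{R}^n$, $\langle\cdot,\cdot\rangle$ is the standard inner product, and $\phi_i(j)=\langle\phi_i,e_j\rangle$ is the $j$-th coordinate of $\phi_i$. For $\alpha\in\mathbb{N}$, the function $f_\alpha$ on $\{1,\dots,n\}$ is defined by $f_\alpha(m)=\log\left(\|A^\alpha e_m\|_{\ell^2}\right)$, where $\|\cdot\|_{\ell^2}$ is the Euclidean norm, $\log$ is the natural logarithm, and $\log 0=-\infty$. An interval in $\{1,\dots,n\}$ is a set of consecutive integers, $|J|$ denotes the number of elements of $J$, and $\operatorname{dist}(m,J)=\min_{j\in J}|m-j|$. *)

(* Defs.v *)
From HB Require Import structures.
From mathcomp Require Import all_boot all_order all_algebra.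
From mathcomp Require Import all_classical all_reals all_analysis.

Set Implicit Arguments.
Unset Strict Implicit.
Unset Printing Implicit Defensive.

Import Order.TTheory GRing.Theory Num.Theory.

Local Open Scope ring_scope.

Definition dotv (R : realType) (n : nat) (u v : 'cV[R]_n) : R :=
  \sum_(j < n) u j 0 * v j 0.

(* The norm that the library puts on matrices is the sup norm. *)
Definition norm2 (R : realType) (n : nat) (v : 'cV[R]_n) : R :=
  Num.sqrt (dotv v v).

Definition std_basis (R : realType) (n : nat) (m : 'I_n) : 'cV[R]_n :=
  delta_mx m 0.

(* A family of n orthonormal vectors of R^n is an orthonormal basis. *)
Definition orthonormal_family (R : realType) (n : nat)
    (phi : 'I_n -> 'cV[R]_n) : Prop :=
  forall i j : 'I_n, dotv (phi i) (phi j) = (i == j)%:R.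

(* [lne] is the extended natural logarithm: [lne 0 = -oo]. *)
Definition log_col_norm (R : realType) (n : nat) (A : 'M[R]_n) (alpha : nat)
    (m : 'I_n) : \bar R :=
  lne (norm2 ((A ^+ alpha) *m std_basis R m))%:E.

Definition consecutive (n : nat) (J : {set 'I_n}) : Prop :=
  exists a b : nat, forall j : 'I_n, (j \in J) = (a <= j <= b)%N.

(* Since |m - j| < n for all m, j in 'I_n, the default value n never affects
   the minimum when J is nonempty; the distance to the empty set is n. *)
Definition dist_set (n : nat) (m : 'I_n) (J : {set 'I_n}) : nat :=
  \big[minn/n]_(j in J) absz (m%:Z - j%:Z).

(* Main.v *)
(* Expanding e_m in the eigenbasis gives |A^alpha e_m|^2 = sum_i lambda_i^(2 alpha) phi_i(m)^2.
   Since phi_i has mass at least 1/2 on J_i, some x in J_i has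
   |A^alpha e_x| >= |lambda_k|^alpha / sqrt(2 Jmax) =: e^y for each i <= k.
   Conversely, at distance d from all J_i the first k terms contribute at most
   k |lambda_1|^(2 alpha) e^(-2 beta d) to |A^alpha e_m|^2, and by Parseval the
   others at most |lambda_{k+1}|^(2 alpha), which by the spectral gap is at most
   |lambda_k|^(2 alpha) / (256 Jmax). With e <= 4, f_alpha(m) >= y - 1 forces
   |A^alpha e_m|^2 >= |lambda_k|^(2 alpha) / (32 Jmax), so the first k terms
   account for at least |lambda_k|^(2 alpha) / (256 Jmax), which bounds d. *)
Require Import Defs.
From HB Require Import structures.
From mathcomp Require Import all_boot all_order all_algebra.
From mathcomp Require Import all_classical all_reals all_analysis.
From mathcomp Require Import ring lra.

Import Order.TTheory GRing.Theory Num.Theory.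

Local Open Scope ring_scope.

Lemma dist_setS {n : nat} (m : 'I_n) {J J' : {set 'I_n}} :
  J \subset J' -> (dist_set m J' <= dist_set m J)%N.
Proof.
move=> sJJ'; rewrite /dist_set -!minEnat -leEnat; apply/bigmin_geP; split=> [|j jJ].
  exact: bigmin_le_id.
exact/bigmin_le_cond/(fintype.subsetP sJJ').
Qed.

(** Positivity of [c] rules out an empty [J]; the sum is then at most [#|J|] times its largest
    term. *)
Lemma le_card_mul_max {R : realType} {T : finType} (J : {set T}) (F : T -> R)
    (c : R) :
  0 < c -> c <= \sum_(j in J) F j -> exists2 x, x \in J & c <= #|J|%:R * F x.
Proof.
move=> c0 cF; have [J0|[x0 x0J]] := set_0Vmem J.
  by move: cF; rewrite J0 big_set0 leNgt c0.
case: (Order.TotalTheory.arg_maxP F x0J) => x xJ xmax.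
exists x => //; rewrite (le_trans cF)// mulr_natl -sumr_const.
exact: ler_sum.
Qed.

(** The inequality 1 + x <= e^x at x = -1/2 gives e^(-1/2) >= 1/2; square and invert. *)
Lemma expR1_le4 (R : realType) : expR 1 <= 4 :> R.
Proof.
have h : 1 / 2 <= expR (- (1 / 2)) :> R.
  by apply: le_trans (expR_ge1Dx _); lra.
have -> : expR 1 = (expR (- (1 / 2)) ^+ 2)^-1 :> R.
  by rewrite -expRM_natl -expRN; congr expR; field.
rewrite -[4]invrK lef_pV2 ?posrE ?exprn_gt0 ?expR_gt0 ?invr_gt0//.
have -> : 4^-1 = (1 / 2) ^+ 2 :> R by field.
by rewrite ler_sqr ?nnegrE ?expR_ge0//; lra.
Qed.

Section Spectral.
Context {R : realType} {n : nat} {phi : 'I_n -> 'cV[R]_n}.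
Hypothesis phi_orthonormal : orthonormal_family phi.

(** Orthonormality says that the matrix [P] with rows [phi i] satisfies P P^T = 1. For a square
    matrix this forces P^T P = 1, whose entries are these sums. *)
Lemma orthonormal_family_complete (a b : 'I_n) :
  \sum_i phi i a 0 * phi i b 0 = (a == b)%:R.
Proof.
pose P := \matrix_(i, j) phi i j 0 : 'M[R]_n.
have PP : P *m P^T = 1%:M.
  apply/matrixP => i j; rewrite !mxE -phi_orthonormal.
  by apply: eq_bigr => l _; rewrite !mxE.
have /matrixP/(_ a b) := mulmx1C PP; rewrite !mxE => <-.
by apply: eq_bigr => l _; rewrite !mxE.
Qed.

Lemma orthonormal_expansion (m : 'I_n) :
  std_basis R m = \sum_i phi i m 0 *: phi i.
Proof.
apply/matrixP => a b; rewrite ord1 mxE andbT summxE eq_sym.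
rewrite -orthonormal_family_complete.
by apply: eq_bigr => i _; rewrite mxE.
Qed.

Lemma dotv_orthonormal_sum (c : 'I_n -> R) :
  dotv (\sum_i c i *: phi i) (\sum_i c i *: phi i) = \sum_i c i ^+ 2.
Proof.
rewrite /dotv.
under eq_bigr do rewrite !summxE big_distrlr /=.
rewrite exchange_big /=; apply: eq_bigr => i _.
rewrite exchange_big /= (bigD1 i)//= [X in _ + X]big1 ?addr0 => [|j ji].
  transitivity (c i ^+ 2 * dotv (phi i) (phi i)).
    by rewrite /dotv mulr_sumr; apply: eq_bigr => l _; rewrite !mxE; ring.
  by rewrite phi_orthonormal eqxx mulr1.
transitivity (c i * c j * dotv (phi i) (phi j)).
  by rewrite /dotv mulr_sumr; apply: eq_bigr => l _; rewrite !mxE; ring.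
by rewrite phi_orthonormal eq_sym (negPf ji) mulr0.
Qed.

Lemma eigen_expmx (A : 'M[R]_n) (v : 'cV[R]_n) (c : R) (a : nat) :
  A *m v = c *: v -> A ^+ a *m v = c ^+ a *: v.
Proof.
move=> Av; elim: a => [|a IH]; first by rewrite !expr0 mul1mx scale1r.
by rewrite exprS -mulmxA IH -scalemxAr Av scalerA -exprSr.
Qed.

Lemma dotv_expmx_basis {A : 'M[R]_n} {lambda : 'I_n -> R} (a : nat) (m : 'I_n) :
  (forall i, A *m phi i = lambda i *: phi i) ->
  dotv (A ^+ a *m std_basis R m) (A ^+ a *m std_basis R m) =
  \sum_i (lambda i ^+ a * phi i m 0) ^+ 2.
Proof.
move=> eig; rewrite -dotv_orthonormal_sum.
suff -> : A ^+ a *m std_basis R m =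
    \sum_i (lambda i ^+ a * phi i m 0) *: phi i by [].
rewrite orthonormal_expansion mulmx_sumr; apply: eq_bigr => i _.
by rewrite -scalemxAr (eigen_expmx _ _ _ _ (eig i)) scalerA mulrC.
Qed.

End Spectral.

(** Turns bounds on f_alpha into bounds on squared norms. At [t = 0] both sides are false: the left
    because [lne 0 = -oo], the right because [s ^+ 2 > 0]. *)
Lemma lne_sqrt_ge {R : realType} (s t : R) : 0 < s -> 0 <= t ->
  ((ln s)%:E <= lne (Num.sqrt t)%:E)%E = (s ^+ 2 <= t).
Proof.
move=> s0 t0; have [->|tn0] := eqVneq t 0.
  by rewrite sqrtr0 le0_lneNy// leeNy_eq/= leNgt exprn_gt0.
have tp : 0 < t by rewrite lt_def tn0.
rewrite lne_EFin ?sqrtr_gt0// lee_fin ler_ln ?posrE ?sqrtr_gt0//.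
by rewrite -{2}(sqr_sqrtr t0) ler_sqr ?nnegrE ?sqrtr_ge0// ltW.
Qed.

Lemma dotv_std_basis {R : realType} {n : nat} (v : 'cV[R]_n) (m : 'I_n) :
  dotv v (std_basis R m) = v m 0.
Proof.
rewrite /dotv (bigD1 m)//= big1 => [|j jm]; rewrite mxE ?eqxx ?addr0 ?mulr1//.
by rewrite (negPf jm) mulr0.
Qed.

(* Indices start at 0: the paper's lambda_1, lambda_k, lambda_{k+1} are
   lambda`_0, lambda`_k.-1, lambda`_k. *)
Theorem mainTheorem1 (R : realType) (n : nat) (A : 'M[R]_n)
    (phi : 'I_n -> 'cV[R]_n) (lambda : n.-tuple R)
    (phi_orthonormal : orthonormal_family phi)
    (phi_eigen : forall i : 'I_n, A *m phi i = lambda`_i *: phi i)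
    (lambda_sorted : forall i j : 'I_n, (i <= j)%N ->
       `|lambda`_j| <= `|lambda`_i|)
    (k : nat) (k_ge1 : (1 <= k)%N) (k_lt_n : (k < n)%N)
    (lambda_neq0 : lambda`_k != 0)
    (J : 'I_k -> {set 'I_n})
    (J_interval : forall i : 'I_k, consecutive (J i))
    (J_mass : forall i : 'I_k,
       \sum_(j in J i) (phi (widen_ord (ltnW k_lt_n) i) j 0) ^+ 2 >= 1 / 2)
    (beta : R) (beta_gt0 : 0 < beta)
    (phi_decay : forall (i : 'I_k) (m : 'I_n),
       `|dotv (phi (widen_ord (ltnW k_lt_n) i)) (std_basis R m)|
         <= expR (- (beta * (dist_set m (J i))%:R)))
    (alpha : nat) :
  let Jmax : nat := (\max_(i < k) #|J i|)%N in
  (`|lambda`_k.-1| / `|lambda`_k|) ^+ alpha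
    >= 16 * Num.sqrt (Jmax%:R * n%:R) ->
  exists y : R,
    (y%:E <= \big[mine/+oo]_(i < k)
               \big[maxe/-oo]_(x in J i) log_col_norm A alpha x)%E /\
    (forall m : 'I_n,
       ((y - 1)%:E <= log_col_norm A alpha m)%E ->
       (dist_set m (\bigcup_(i < k) J i)%SET)%:R
         <= 1 / beta *
            (ln (16 * Num.sqrt k%:R * Num.sqrt Jmax%:R)
             + alpha%:R * ln `|lambda`_0 / lambda`_k.-1|)).
Proof.
move=> Jmax gap.
pose w := widen_ord (ltnW k_lt_n).
pose N (m : 'I_n) := \sum_(i < n) (lambda`_i ^+ alpha * phi i m 0) ^+ 2.
have logE m : log_col_norm A alpha m = lne (Num.sqrt (N m))%:E.
  rewrite /log_col_norm /norm2.
  by rewrite (dotv_expmx_basis phi_orthonormal (lambda := fun i : 'I_n => lambda`_i)).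
have N_ge0 m : 0 <= N m by apply: sumr_ge0 => i _; exact: sqr_ge0.
have mass i : exists2 x, x \in J i & 1 / 2 <= Jmax%:R * phi (w i) x 0 ^+ 2.
  have [||x xJ h] := @le_card_mul_max R _ (J i) (fun j => phi (w i) j 0 ^+ 2) (1 / 2).
  - by rewrite divr_gt0.
  - exact: J_mass.
  exists x => //; apply: le_trans h _.
  by rewrite ler_wpM2r ?sqr_ge0// ler_nat (leq_bigmax (F := fun i => #|J i|)).
have n_gt0 : (0 < n)%N := leq_trans (ltn0Sn _) k_lt_n.
have Jmax_gt0 : 0 < Jmax%:R :> R.
  (* [Jmax = 0] would turn the mass bound for the first eigenvector into 1/2 <= 0. *)
  have [x _] := mass (Ordinal k_ge1); rewrite lt_def ler0n andbT.
  by apply: contraTneq => ->; rewrite mul0r -ltNge divr_gt0.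
have km1_n : (k.-1 < n)%N by rewrite prednK// ltnW.
have lk_gt0 : 0 < `|lambda`_k| by rewrite normr_gt0.
have lk1_gt0 : 0 < `|lambda`_k.-1|.
  apply: lt_le_trans lk_gt0 _.
  by apply: (lambda_sorted (Ordinal km1_n) (Ordinal k_lt_n)); exact: leq_pred.
have l0_gt0 : 0 < `|lambda`_0|.
  by apply: lt_le_trans lk1_gt0 _; exact: (lambda_sorted (Ordinal n_gt0) (Ordinal km1_n)).
set a := `|lambda`_k.-1| ^+ alpha.
have a_gt0 : 0 < a by rewrite exprn_gt0.
pose s := a / Num.sqrt (2 * Jmax%:R).
have J2_gt0 : 0 < 2 * Jmax%:R :> R by rewrite mulr_gt0.
have s_gt0 : 0 < s by rewrite divr_gt0// sqrtr_gt0.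
have s2 : s ^+ 2 = a ^+ 2 / (2 * Jmax%:R) by rewrite expr_div_n sqr_sqrtr// ltW.
clearbody s.
exists (ln s); split.
  apply/bigmin_geP; split=> [|i _]; first exact: leey.
  have [x xJ xmass] := mass i.
  apply: (le_trans _ (le_bigmax_cond _ _ xJ)).
  rewrite logE lne_sqrt_ge// s2 ler_pdivrMr//.
  have lam : a ^+ 2 * phi (w i) x 0 ^+ 2 <= N x.
    rewrite /N (bigD1 (w i))//= -[leLHS]addr0 lerD//; last first.
      by apply: sumr_ge0 => j _; exact: sqr_ge0.
    rewrite exprMn ler_wpM2r ?sqr_ge0// -[leRHS]real_normK ?num_real//.
    rewrite ler_sqr ?nnegrE ?(ltW a_gt0)// normrX lerXn2r ?nnegrE//.
    apply: (lambda_sorted (w i) (Ordinal km1_n)) => /=.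
    by rewrite -ltnS prednK.
  have := ler_wpM2l (sqr_ge0 a) xmass.
  have := ler_wpM2r (ltW J2_gt0) lam.
  lra.
move=> m.
set d := dist_set _ _; set E := expR (- (beta * d%:R)).
have -> : ln s - 1 = ln (s / expR 1).
  by rewrite ln_div ?posrE ?expR_gt0// expRK.
rewrite logE lne_sqrt_ge ?divr_gt0 ?expR_gt0// => Nm_ge.
set b := `|lambda`_0| ^+ alpha; set c := `|lambda`_k| ^+ alpha.
have b_gt0 : 0 < b by rewrite exprn_gt0.
have c_gt0 : 0 < c by rewrite exprn_gt0.
have bE_gt0 : 0 < b * E by rewrite mulr_gt0 ?expR_gt0.
have Nm_le : N m <= k%:R * (b * E) ^+ 2 + c ^+ 2.
  (* Both parts of the bound become sums over all [i < n], the first cut off at [k] and the second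
     spread out by Parseval, so that the comparison is termwise. *)
  have -> : c ^+ 2 = \sum_i c ^+ 2 * (phi i m 0 * phi i m 0).
    by rewrite -mulr_sumr orthonormal_family_complete// eqxx mulr1.
  have -> : k%:R * (b * E) ^+ 2 = \sum_(i < n) (if (i < k)%N then (b * E) ^+ 2 else 0).
    rewrite -big_mkcond -(big_ord_widen n (fun=> (b * E) ^+ 2) (ltnW k_lt_n)).
    by rewrite sumr_const card_ord mulr_natl.
  rewrite -big_split; apply: ler_sum => i _ /=; rewrite -expr2.
  case: ltnP => [ik|ki].
    apply: ler_wpDr; first by rewrite mulr_ge0 ?sqr_ge0.
    rewrite -[leLHS]real_normK ?num_real// ler_sqr ?nnegrE ?(ltW bE_gt0)//.
    rewrite normrM normrX ler_pM ?exprn_ge0//.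
      by rewrite lerXn2r ?nnegrE//; exact: (lambda_sorted (Ordinal n_gt0) i).
    have iE : i = w (Ordinal ik) by exact: val_inj.
    have := phi_decay (Ordinal ik) m; rewrite dotv_std_basis -/w -iE.
    (* The distance [d] to the union is at most the distance to [J i], so the decay bound is at most
       [E]. *)
    move=> /le_trans; apply; rewrite ler_expR lerN2 ler_pM2l// ler_nat.
    exact/dist_setS/(finset.bigcup_sup (Ordinal ik)).
  rewrite add0r exprMn ler_wpM2r ?sqr_ge0// -[leLHS]real_normK ?num_real//.
  rewrite ler_sqr ?nnegrE ?(ltW c_gt0)// normrX lerXn2r ?nnegrE//.
  exact: (lambda_sorted (Ordinal k_lt_n) i).
have c_le : 256 * Jmax%:R * c ^+ 2 <= a ^+ 2.
  (* Clear the denominator in [gap], bound the root below using n >= 1, and square: 16 becomes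
     256. *)
  have : 16 * Num.sqrt (Jmax%:R * n%:R) * c <= a.
    by move: gap; rewrite expr_div_n ler_pdivlMr.
  have : 16 * Num.sqrt Jmax%:R * c <= 16 * Num.sqrt (Jmax%:R * n%:R) * c.
    rewrite ler_pM2r// ler_pM2l// ler_wsqrtr// ler_peMr ?(ltW Jmax_gt0)//.
    by rewrite ler1n.
  move=> /le_trans /[apply]; rewrite -ler_sqr ?nnegrE ?(ltW a_gt0)//; last first.
    by rewrite !mulr_ge0 ?sqrtr_ge0// ltW.
  rewrite !exprMn sqr_sqrtr ?(ltW Jmax_gt0)//; lra.
(* With X = (bE)^2 and e^2 <= 16, the two bounds on [N m] give a^2 <= 32 Jmax (k X + c^2). By [c_le]
   the [c] part is at most a^2/8, so (7/8) a^2 <= 32 k Jmax X, which is within the claimed 256 k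
   Jmax X. *)
have a_le2 : a ^+ 2 <= (16 * Num.sqrt k%:R * Num.sqrt Jmax%:R * (b * E)) ^+ 2.
  have e2 : expR 1 ^+ 2 <= 16 :> R.
    have -> : 16 = 4 ^+ 2 :> R by ring.
    by rewrite ler_sqr ?nnegrE ?expR_ge0 ?expR1_le4.
  move: (le_trans Nm_ge Nm_le); rewrite expr_div_n s2 ler_pdivrMr ?exprn_gt0 ?expR_gt0//.
  rewrite ler_pdivrMr// [in leRHS]exprMn !exprMn !sqr_sqrtr ?ler0n//.
  rewrite -!exprMn.
  have := sqr_ge0 (b * E); set X := (b * E) ^+ 2 => X_ge0 h.
  have {h} : a ^+ 2 <= (k%:R * X + c ^+ 2) * 16 * (2 * Jmax%:R).
    apply: le_trans h _; rewrite ler_pM2r// ler_wpM2l//.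
    by apply: addr_ge0; [apply: mulr_ge0|exact: sqr_ge0].
  have : 0 <= k%:R * X * Jmax%:R by apply: mulr_ge0 => //; apply: mulr_ge0.
  lra.
set C := 16 * Num.sqrt k%:R * Num.sqrt Jmax%:R in a_le2 *.
have C_gt0 : 0 < C by rewrite !mulr_gt0 ?sqrtr_gt0// ltr0n.
have a_le : a <= C * (b * E).
  by rewrite -ler_sqr ?nnegrE ?(ltW a_gt0) ?(ltW (mulr_gt0 C_gt0 bE_gt0)).
have q_gt0 : 0 < `|lambda`_0 / lambda`_k.-1| by rewrite normf_div divr_gt0.
(* Exponentiated, the goal reads e^(beta d) <= C b / a, which is [a_le] since E = e^(-beta d). *)
rewrite mulrC mul1r ler_pdivlMr// mulrC -ler_expR expRD lnK ?posrE//.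
rewrite mulr_natl -lnXn// lnK ?posrE ?exprn_gt0//.
rewrite normf_div expr_div_n -/a -/b mulrA ler_pdivlMr//.
by move: a_le; rewrite mulrA /E expRN ler_pdivlMr ?expR_gt0// [a * _]mulrC.
Qed.
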